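(* Vaught's set theory $\mathsf{VS}$ is $\mathsf{R}_{0\mathsf{p}}$-sourced, i.e., there is a translation $\tau$ from $\mathbb{L}_{\sf ap}$ into the signature $\{\in\}$ such that $\mathsf{VS}$ is deductively equivalent to $(\mathsf{R}_{0\mathsf{p}}+\mathfrak{id}_{\sf ap})^\tau$.
   Context: $\mathsf{VS}$ is the theory in the signature with a single binary relation symbol $\in$ whose axioms are, for each $n\in\omega$, $\forall x_0\ldots\forall x_{n-1}\,\exists z\,\forall y\,(y\in z\leftrightarrow\bigvee_{i<n}y=x_i)$. $\mathbb{L}_{\sf a}=\{0,\mathsf{S},+,\times,\leq\}$ with $\leq$ primitive; $\mathbb{L}_{\sf ap}$ is $\mathbb{L}_{\sf a}$ plus a unary predicate $\mathsf{P}$; $\mathfrak{id}_{\sf ap}$ are the identity axioms for $\mathbb{L}_{\sf ap}$. $\mathsf{R}_0$ is the $\mathbb{L}_{\sf a}$-theory with axioms, for all $m,n\in\omega$: $\overline{m}+\overline{n}=\overline{m+n}$; $\overline{m}\times\overline{n}=\overline{m\times n}$; $\overline{m}\neq\overline{n}$ if $m\neq n$; $\forall x\,(x\leq\overline{n}\to\bigvee_{i\leq n}x=\overline{i})$; $\overline{m}\leq\overline{n}$ if $m\leq n$ ($\overline{n}$ the numerals). $\mathsf{R}_{0\mathsf{p}}$ is $\mathsf{R}_0$ plus $\mathsf{P}(\overline{n})$ for all $n$. A translation assigns a domain formula and to each relation symbol (identity included; function symbols via graphs) a formula of the target signature, extended to all formulas by commuting with connectives and relativizing quantifiers to the domain;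 $\Gamma^\tau$ is the set of translations of members of $\Gamma$. *)

(* Defs.v *)
From Stdlib Require List.
From mathcomp Require Import all_boot.

Set Implicit Arguments.
Unset Strict Implicit.
Unset Printing Implicit Defensive.

Record signature := Signature { sym : Type; arity : sym -> nat }.

(* Variables are de Bruijn indices.  Identity is a logical symbol; the other
   connectives are the usual classical abbreviations. *)
Inductive form (Sg : signature) : Type :=
| Bot
| Eq of nat & nat
| Rel (r : sym Sg) of (arity r).-tuple nat
| Imp of form Sg & form Sg
| All of form Sg.

Arguments Bot {Sg}.
Arguments Eq {Sg}.
Arguments Rel {Sg}.

Section Syntax.
Variable Sg : signature.
Implicit Types (phi psi : form Sg).

Definition Neg phi := Imp phi Bot.
Definition Or phi psi := Imp (Neg phi) psi.
Definition And phi psi := Neg (Imp phi (Neg psi)).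
Definition Iff phi psi := And (Imp phi psi) (Imp psi phi).
Definition Ex phi := Neg (All (Neg phi)).
Definition BigOr (s : seq (form Sg)) : form Sg := foldr Or Bot s.
Definition Alls (n : nat) phi : form Sg := iter n (@All Sg) phi.

Definition up (f : nat -> nat) (i : nat) : nat :=
  if i is j.+1 then (f j).+1 else 0.

Fixpoint rename (f : nat -> nat) phi : form Sg :=
  match phi with
  | Bot => Bot
  | Eq x y => Eq (f x) (f y)
  | Rel r v => Rel r (map_tuple f v)
  | Imp phi1 phi2 => Imp (rename f phi1) (rename f phi2)
  | All phi1 => All (rename (up f) phi1)
  end.

Definition shift phi := rename S phi.

(* [subst0 x phi] replaces variable 0 by x and lowers the other variables. *)
Definition subst0 (x : nat) phi :=
  rename (fun i => if i is j.+1 then j else x) phi.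

(* [plug phi v] is phi(v_0, v_1, ...). *)
Definition plug phi (v : seq nat) := rename (nth 0 v) phi.

Fixpoint bounded (n : nat) phi : bool :=
  match phi with
  | Bot => true
  | Eq x y => (x < n) && (y < n)
  | Rel r v => all (fun x => x < n) v
  | Imp phi1 phi2 => bounded n phi1 && bounded n phi2
  | All phi1 => bounded n.+1 phi1
  end.

Inductive nd : seq (form Sg) -> form Sg -> Prop :=
| nd_hyp G phi : List.In phi G -> nd G phi
| nd_impI G phi psi : nd (phi :: G) psi -> nd G (Imp phi psi)
| nd_impE G phi psi : nd G (Imp phi psi) -> nd G phi -> nd G psi
| nd_raa G phi : nd (Neg phi :: G) Bot -> nd G phi
| nd_allI G phi : nd (map shift G) phi -> nd G (All phi)
| nd_allE G phi x : nd G (All phi) -> nd G (subst0 x phi)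
| nd_eqI G x : nd G (Eq x x)
| nd_eqE G phi x y : nd G (Eq x y) -> nd G (subst0 x phi) -> nd G (subst0 y phi).

Definition theory := form Sg -> Prop.

Definition proves (T : theory) phi : Prop :=
  exists G, (forall psi, List.In psi G -> T psi) /\ nd G phi.

Definition deductively_equivalent (T U : theory) : Prop :=
  forall phi, proves T phi <-> proves U phi.

Inductive congruence_axioms : theory :=
| id_refl : congruence_axioms (All (Eq 0 0))
| id_sym : congruence_axioms (Alls 2 (Imp (Eq 0 1) (Eq 1 0)))
| id_trans : congruence_axioms (Alls 3 (Imp (Eq 0 1) (Imp (Eq 1 2) (Eq 0 2))))
| id_cong (r : sym Sg) : congruence_axioms
    (Alls (arity r + arity r)
      (foldr (@Imp Sg)
        (Imp (Rel r [tuple val i | i < arity r])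
             (Rel r [tuple arity r + val i | i < arity r]))
        [seq Eq i (arity r + i) | i <- iota 0 (arity r)])).

End Syntax.

(* The [bounded] conditions say that the formulas have no free variables
   besides their argument places: translations are without parameters. *)
Record translation (Sg Th : signature) := Translation {
  tdom : form Th;
  teq : form Th;
  trel : sym Sg -> form Th;
  tdom_bounded : bounded 1 tdom;
  teq_bounded : bounded 2 teq;
  trel_bounded : forall r, bounded (arity r) (trel r)
}.

Section Translate.
Variables (Sg Th : signature) (tau : translation Sg Th).

Fixpoint translate (phi : form Sg) : form Th :=
  match phi with
  | Bot => Bot
  | Eq x y => plug (teq tau) [:: x; y]
  | Rel r v => plug (trel tau r) v
  | Imp phi1 phi2 => Imp (translate phi1) (translate phi2)
  | All phi1 => All (Imp (plug (tdom tau) [:: 0]) (translate phi1))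
  end.

Definition translate_theory (T : theory Sg) : theory Th :=
  fun psi => exists phi, T phi /\ psi = translate phi.

End Translate.

Definition theory_union (Sg : signature) (T U : theory Sg) : theory Sg :=
  fun phi => T phi \/ U phi.

Definition set_sig : signature := Signature (fun _ : unit => 2).

Definition in_ (x y : nat) : form set_sig := @Rel set_sig tt [tuple x; y].

(* Under the binders, y is 0, z is 1 and x_0, ..., x_{n-1} are 2, ..., n+1. *)
Definition VS_axiom (n : nat) : form set_sig :=
  Alls n (Ex (All (Iff (in_ 0 1) (BigOr [seq Eq 0 i.+2 | i <- iota 0 n])))).

Inductive VS : theory set_sig := VS_intro n : VS (VS_axiom n).

(* Function symbols are represented by their graphs, the value being the last
   argument. *)
Inductive ap_sym := ZeroG | SuccG | AddG | MulG | LeS | PS.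

Definition ap_arity (r : ap_sym) : nat :=
  match r with
  | ZeroG => 1 | SuccG => 2 | AddG => 3 | MulG => 3 | LeS => 2 | PS => 1
  end.

Definition ap_sig : signature := Signature ap_arity.

Definition zero_ (z : nat) : form ap_sig := @Rel ap_sig ZeroG [tuple z].
Definition succ_ (x z : nat) : form ap_sig := @Rel ap_sig SuccG [tuple x; z].
Definition add_ (x y z : nat) : form ap_sig := @Rel ap_sig AddG [tuple x; y; z].
Definition mul_ (x y z : nat) : form ap_sig := @Rel ap_sig MulG [tuple x; y; z].
Definition le_ (x y : nat) : form ap_sig := @Rel ap_sig LeS [tuple x; y].
Definition p_ (x : nat) : form ap_sig := @Rel ap_sig PS [tuple x].

Inductive term := TVar of nat | TZero | TSucc of term
  | TAdd of term & term | TMul of term & term.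

Definition numeral (n : nat) : term := iter n TSucc TZero.

(* [value t d z] unravels "t = z", where the variables of t are shifted by d
   (the number of binders crossed so far). *)
Fixpoint value (t : term) (d z : nat) : form ap_sig :=
  match t with
  | TVar x => Eq (d + x) z
  | TZero => zero_ z
  | TSucc t1 => Ex (And (value t1 d.+1 0) (succ_ 0 z.+1))
  | TAdd t1 t2 =>
      Ex (Ex (And (value t1 d.+2 1) (And (value t2 d.+2 0) (add_ 1 0 z.+2))))
  | TMul t1 t2 =>
      Ex (Ex (And (value t1 d.+2 1) (And (value t2 d.+2 0) (mul_ 1 0 z.+2))))
  end.

Definition EqT (t1 t2 : term) : form ap_sig :=
  Ex (Ex (And (value t1 2 1) (And (value t2 2 0) (Eq 1 0)))).
Definition LeT (t1 t2 : term) : form ap_sig :=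
  Ex (Ex (And (value t1 2 1) (And (value t2 2 0) (le_ 1 0)))).
Definition PT (t : term) : form ap_sig :=
  Ex (And (value t 1 0) (p_ 0)).

Inductive R0 : theory ap_sig :=
| R0_add m n : R0 (EqT (TAdd (numeral m) (numeral n)) (numeral (m + n)))
| R0_mul m n : R0 (EqT (TMul (numeral m) (numeral n)) (numeral (m * n)))
| R0_neq m n : m <> n -> R0 (Neg (EqT (numeral m) (numeral n)))
| R0_bound n : R0 (All (Imp (LeT (TVar 0) (numeral n))
    (BigOr [seq EqT (TVar 0) (numeral i) | i <- iota 0 n.+1])))
| R0_le m n : m <= n -> R0 (LeT (numeral m) (numeral n)).

Inductive R0p : theory ap_sig :=
| R0p_R0 phi : R0 phi -> R0p phi
| R0p_P n : R0p (PT (numeral n)).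

(* Since function symbols are represented by graphs, the laws of identity
   include that the graphs are total and single-valued. *)
Inductive id_ap : theory ap_sig :=
| id_ap_cong phi : congruence_axioms phi -> id_ap phi
| id_ap_zero_tot : id_ap (Ex (zero_ 0))
| id_ap_zero_fun : id_ap (Alls 2 (Imp (zero_ 0) (Imp (zero_ 1) (Eq 0 1))))
| id_ap_succ_tot : id_ap (All (Ex (succ_ 1 0)))
| id_ap_succ_fun : id_ap (Alls 3 (Imp (succ_ 2 0) (Imp (succ_ 2 1) (Eq 0 1))))
| id_ap_add_tot : id_ap (Alls 2 (Ex (add_ 1 2 0)))
| id_ap_add_fun :
    id_ap (Alls 4 (Imp (add_ 2 3 0) (Imp (add_ 2 3 1) (Eq 0 1))))
| id_ap_mul_tot : id_ap (Alls 2 (Ex (mul_ 1 2 0)))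
| id_ap_mul_fun :
    id_ap (Alls 4 (Imp (mul_ 2 3 0) (Imp (mul_ 2 3 1) (Eq 0 1)))).

(* Main.v *)
From mathcomp Require Import all_boot boolp.
Require Import Defs.

Set Implicit Arguments.
Unset Strict Implicit.
Unset Printing Implicit Defensive.

(** The natural number n is interpreted as the class of all sets with n elements:
    every set is a number, and two sets are identified when they have bijections
    with the same sets, which is an equivalence relation in every structure.
    Addition and multiplication are cardinal addition and multiplication, and
    P(x) says that the empty set and unordered pairs exist and that y can be
    adjoined to every set of the size of x, for every y.  The axiom P(n) thus yields
    the (n+1)-element sets from the n-element ones, so by induction on n all
    axioms of VS follow.  Conversely, in VS the sets needed to witness the finite
    arithmetical facts (bijections, disjoint unions, products) are themselves
    finite; enough elements exist by Russell's paradox.  The two theories have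
    the same models, and the completeness theorem concludes. *)

(** * Completeness *)

Definition scons (D : Type) (d : D) (rho : nat -> D) (i : nat) : D :=
  if i is j.+1 then rho j else d.

(** * Renaming of variables in formulas and derivations *)

Section Renaming.
Variable Sg : signature.
Implicit Types (phi psi : form Sg) (f g : nat -> nat).

Lemma rename_ext f g phi : f =1 g -> rename f phi = rename g phi.
Proof.
elim: phi f g => //= [x y|r v|phi1 IH1 phi2 IH2|phi1 IH] f g fg.
- by rewrite !fg.
- by congr Rel; apply: val_inj; apply: eq_map.
- by rewrite (IH1 _ _ fg) (IH2 _ _ fg).
- by rewrite (IH _ (up g)) // => -[|i] //=; rewrite fg.
Qed.

Lemma rename_comp f g phi : rename f (rename g phi) = rename (f \o g) phi.
Proof.
elim: phi f g => //= [r v|phi1 IH1 phi2 IH2|phi1 IH] f g.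
- by congr Rel; apply: val_inj; rewrite /= -map_comp.
- by rewrite IH1 IH2.
- by rewrite IH; congr All; apply: rename_ext => -[|i].
Qed.

Lemma rename_id phi : rename id phi = phi.
Proof.
elim: phi => //= [r v|phi1 -> phi2 ->|phi1 IH] //.
- by congr Rel; apply: val_inj; rewrite /= map_id.
- by rewrite -[in RHS]IH; congr All; apply: rename_ext => -[|i].
Qed.

Lemma rename_bounded f g n phi :
  bounded n phi -> (forall i, i < n -> f i = g i) -> rename f phi = rename g phi.
Proof.
elim: phi n f g => //= [x y|r v|phi1 IH1 phi2 IH2|phi1 IH] n f g.
- by move=> /andP[xn yn] fg; rewrite !fg.
- move=> /allP vn fg; congr Rel; apply: val_inj.
  by apply/eq_in_map => x xv; apply/fg/vn.
- by move=> /andP[b1 b2] fg; rewrite (IH1 n f g) // (IH2 n f g).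
- by move=> b fg; rewrite (IH _ _ (up g) b) // => -[|i] //= /fg ->.
Qed.

Lemma bounded_leq m n phi : m <= n -> bounded m phi -> bounded n phi.
Proof.
elim: phi m n => //= [x y|r v|phi1 IH1 phi2 IH2|phi1 IH] m n mn.
- by move=> /andP[xm ym]; rewrite !(leq_trans _ mn).
- by apply: sub_all => x xm; apply: leq_trans mn.
- by move=> /andP[b1 b2]; rewrite (IH1 _ _ mn b1) (IH2 _ _ mn b2).
- exact: IH.
Qed.

Lemma bounded_exists phi : exists n, bounded n phi.
Proof.
elim: phi => [|x y|r v|phi1 [n1 b1] phi2 [n2 b2]|phi1 [n b]]; first by exists 0.
- by exists (maxn x y).+1; rewrite /= !ltnS leq_maxl leq_maxr.
- exists (foldr maxn 0 v).+1 => /=; elim: (val v) => //= x s IH.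
  rewrite ltnS leq_maxl /=; apply: sub_all IH => y; rewrite !ltnS => ys.
  by rewrite (leq_trans ys) // leq_maxr.
- exists (maxn n1 n2) => /=.
  by rewrite (bounded_leq (leq_maxl _ _) b1) (bounded_leq (leq_maxr _ _) b2).
- by exists n; apply: bounded_leq b.
Qed.

Lemma subst0_rename f x phi :
  subst0 (f x) (rename (up f) phi) = rename f (subst0 x phi).
Proof. by rewrite /subst0 !rename_comp; apply: rename_ext => -[|i]. Qed.

Lemma subst0_up f x phi : subst0 x (rename (up f) phi) = rename (scons x f) phi.
Proof. by rewrite /subst0 rename_comp; apply: rename_ext => -[|i]. Qed.

Lemma shift_rename f phi : shift (rename f phi) = rename (up f) (shift phi).
Proof. by rewrite /shift !rename_comp; apply: rename_ext. Qed.

(** No injectivity is asked of [f]: identifying variables keeps a derivation correct. This is what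
    allows renaming by [half] and by [unfresh] below. *)
Lemma nd_rename f (G : seq (form Sg)) phi :
  nd G phi -> nd (map (rename f) G) (rename f phi).
Proof.
move=> d; elim: d f => {G phi}.
- by move=> G phi Gphi f; apply: nd_hyp; apply: List.in_map.
- by move=> G phi psi _ IH f; apply: nd_impI; apply: IH.
- by move=> G phi psi _ IH1 _ IH2 f; apply: nd_impE (IH1 f) (IH2 f).
- by move=> G phi _ IH f; apply: nd_raa; apply: IH.
- move=> G phi _ IH f; apply: nd_allI.
  suff -> : map (@shift Sg) (map (rename f) G) =
            map (rename (up f)) (map (@shift Sg) G) by [].
  by rewrite -!map_comp; apply: eq_map => psi /=; rewrite shift_rename.
- by move=> G phi x _ IH f; rewrite -subst0_rename; apply: nd_allE; apply: IH.
- by move=> G x f; apply: nd_eqI.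
- move=> G phi x y _ IH1 _ IH2 f; rewrite -subst0_rename.
  by apply: (nd_eqE (IH1 f)); rewrite subst0_rename.
Qed.

Lemma nd_weaken (G G' : seq (form Sg)) phi :
  (forall psi, List.In psi G -> List.In psi G') -> nd G phi -> nd G' phi.
Proof.
move=> + d; elim: d G' => {G phi}.
- by move=> G phi Gphi G' GG'; apply: nd_hyp; apply: GG'.
- move=> G phi psi _ IH G' GG'; apply: nd_impI; apply: IH => chi /=.
  by case=> [->|/GG']; [left|right].
- by move=> G phi psi _ IH1 _ IH2 G' GG'; apply: nd_impE (IH1 _ GG') (IH2 _ GG').
- move=> G phi _ IH G' GG'; apply: nd_raa; apply: IH => chi /=.
  by case=> [->|/GG']; [left|right].
- move=> G phi _ IH G' GG'; apply: nd_allI; apply: IH => chi.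
  by move/List.in_map_iff => [psi [<- /GG' ?]]; apply: List.in_map.
- by move=> G phi x _ IH G' GG'; apply: nd_allE; apply: IH.
- by move=> G x G' _; apply: nd_eqI.
- by move=> G phi x y _ IH1 _ IH2 G' GG'; apply: nd_eqE (IH1 _ GG') (IH2 _ GG').
Qed.

End Renaming.

(** * Derived rules for provability from a theory *)

Section Provability.
Variable Sg : signature.
Implicit Types (T U : theory Sg) (phi psi : form Sg).

Definition extend T phi : theory Sg := theory_union T (eq phi).

Definition consistent T := ~ proves T Bot.

Lemma proves_mono T U phi :
  (forall psi, T psi -> U psi) -> proves T phi -> proves U phi.
Proof. by move=> TU [G [GT d]]; exists G; split=> // psi /GT/TU. Qed.

Lemma proves_hyp T phi : T phi -> proves T phi.
Proof.
by move=> Tphi; exists [:: phi]; split; [move=> psi [<-|[]]|apply: nd_hyp; left].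
Qed.

Lemma proves_impE T phi psi : proves T (Imp phi psi) -> proves T phi -> proves T psi.
Proof.
move=> [G1 [T1 d1]] [G2 [T2 d2]]; exists (G1 ++ G2); split.
  by move=> chi /List.in_app_iff[/T1|/T2].
by apply: nd_impE; [apply: nd_weaken d1|apply: nd_weaken d2] => chi ?;
  apply/List.in_app_iff; [left|right].
Qed.

(** The finite list of axioms used may contain [phi] anywhere and repeatedly; the members coming
    from [T] are collected, and one copy of [phi] is put in front, ready for discharge. *)
Lemma nd_of_extend T phi psi : proves (extend T phi) psi ->
  exists G, (forall chi, List.In chi G -> T chi) /\ nd (phi :: G) psi.
Proof.
move=> [G [GT d]].
suff [G' [TG' GG']] : exists G', (forall chi, List.In chi G' -> T chi) /\
    (forall chi, List.In chi G -> List.In chi (phi :: G')).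
  by exists G'; split=> //; apply: nd_weaken d.
elim: G {d} GT => [|chi G IH] GT; first by exists [::]; split.
have [|G' [TG' GG']] := IH; first by move=> xi xiG; apply: GT; right.
have [Tchi|<-] := GT chi (or_introl erefl).
  exists (chi :: G'); split=> [xi [<-|/TG']|xi [<-|/GG' /= [|]]] //=; auto.
by exists G'; split=> // xi [<-|/GG'] //=; auto.
Qed.

Lemma proves_impI T phi psi : proves (extend T phi) psi -> proves T (Imp phi psi).
Proof. by move=> /nd_of_extend[G [GT d]]; exists G; split=> //; apply: nd_impI. Qed.

Lemma proves_raa T phi : proves (extend T (Neg phi)) Bot -> proves T phi.
Proof. by move=> /nd_of_extend[G [GT d]]; exists G; split=> //; apply: nd_raa. Qed.

Lemma proves_exfalso T phi : proves T Bot -> proves T phi.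
Proof. by move=> d; apply: proves_raa; apply: proves_mono d; left. Qed.

Lemma proves_allE T phi x : proves T (All phi) -> proves T (subst0 x phi).
Proof. by move=> [G [GT d]]; exists G; split=> //; apply: nd_allE. Qed.

Lemma proves_eqI T x : proves T (Eq x x).
Proof. by exists [::]; split=> //; apply: nd_eqI. Qed.

Lemma proves_eqE T phi x y :
  proves T (Eq x y) -> proves T (subst0 x phi) -> proves T (subst0 y phi).
Proof.
move=> [G1 [T1 d1]] [G2 [T2 d2]]; exists (G1 ++ G2); split.
  by move=> chi /List.in_app_iff[/T1|/T2].
by apply: nd_eqE; [apply: nd_weaken d1|apply: nd_weaken d2] => chi ?;
  apply/List.in_app_iff; [left|right].
Qed.

Lemma proves_eq_sym T x y : proves T (Eq x y) -> proves T (Eq y x).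
Proof.
by move=> xy; apply: (proves_eqE (phi := Eq 0 x.+1) xy); apply: proves_eqI.
Qed.

Lemma proves_eq_trans T x y z :
  proves T (Eq x y) -> proves T (Eq y z) -> proves T (Eq x z).
Proof. by move=> xy yz; apply: (proves_eqE (phi := Eq x.+1 0) yz xy). Qed.

(** The rule [nd_eqE] replaces a single variable, so the coordinates are exchanged one at a time, by
    induction on the number [k] of those already exchanged. *)
Lemma proves_rel T r (v w : (arity r).-tuple nat) :
  (forall i, proves T (Eq (tnth v i) (tnth w i))) ->
  proves T (Rel r v) -> proves T (Rel r w).
Proof.
move=> vw Tv.
suff: forall k, proves T (Rel r [tuple (if i < k then tnth w i else tnth v i) | i < arity r]).
  move=> /(_ (arity r)); congr (proves _ (Rel _ _)).
  by apply: eq_from_tnth => i; rewrite tnth_mktuple ltn_ord.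
elim=> [|k IH].
  by move: Tv; congr (proves _ (Rel _ _)); apply: eq_from_tnth => i; rewrite tnth_mktuple.
have [kr|rk] := ltnP k (arity r); last first.
  move: IH; congr (proves _ (Rel _ _)); apply: eq_from_tnth => i.
  by rewrite !tnth_mktuple ltnS !(leq_trans _ rk) // ltnW.
(* Variable 0 marks the hole at place [k]; the other entries are raised by one because [subst0]
   lowers them again. *)
pose phi : form Sg := Rel r [tuple (if i < k then (tnth w i).+1 else
                             if i == k :> nat then 0 else (tnth v i).+1) | i < arity r].
have substE x : subst0 x phi = Rel r [tuple (if i < k then tnth w i else
                               if i == k :> nat then x else tnth v i) | i < arity r].
  congr Rel; apply: eq_from_tnth => i; rewrite tnth_map !tnth_mktuple.
  by case: ltnP => //; case: eqP.
have := @proves_eqE T phi _ _ (vw (Ordinal kr)); rewrite !substE => step.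
suff: proves T (Rel r [tuple (if i < k then tnth w i else
                if i == k :> nat then tnth w (Ordinal kr) else tnth v i) | i < arity r]).
  congr (proves _ (Rel _ _)); apply: eq_from_tnth => i; rewrite !tnth_mktuple ltnS.
  case: (ltngtP i k) => //= ik; by congr tnth; apply: val_inj.
apply: step; move: IH; congr (proves _ (Rel _ _)); apply: eq_from_tnth => i.
rewrite !tnth_mktuple; case: (ltngtP i k) => //= ik.
by congr tnth; apply: val_inj.
Qed.

End Provability.

(** * Satisfaction and soundness *)

Section Semantics.
Variables (Sg : signature) (D : Type) (eqv : D -> D -> Prop).
Variable rel : sym Sg -> seq D -> Prop.

(** Identity is read as an arbitrary relation [eqv]: genuine models take [eq], while the arithmetic
    interpreted in a structure of sets takes equinumerosity. *)
Fixpoint sat (rho : nat -> D) (phi : form Sg) : Prop :=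
  match phi with
  | Bot => False
  | Eq x y => eqv (rho x) (rho y)
  | Rel r v => rel r (map rho v)
  | Imp phi1 phi2 => sat rho phi1 -> sat rho phi2
  | All phi1 => forall d, sat (scons d rho) phi1
  end.

Lemma sat_rename f rho phi : sat rho (rename f phi) <-> sat (rho \o f) phi.
Proof.
elim: phi f rho => //= [r v|phi1 IH1 phi2 IH2|phi1 IH] f rho.
- by rewrite -map_comp.
- by split=> H /IH1 /H /IH2.
- have E d : scons d rho \o up f = scons d (rho \o f) by apply/funext => -[|i].
  by split=> H d; have:= H d; rewrite IH E.
Qed.

Lemma sat_subst0 rho x phi :
  sat rho (subst0 x phi) <-> sat (scons (rho x) rho) phi.
Proof.
rewrite sat_rename; suff -> : rho \o (fun i => if i is j.+1 then j else x) =
  scons (rho x) rho by [].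
by apply/funext => -[|i].
Qed.

End Semantics.

Lemma soundness (Sg : signature) (D : Type) (rel : sym Sg -> seq D -> Prop) G phi :
  nd G phi -> forall rho : nat -> D,
  (forall psi, List.In psi G -> sat eq rel rho psi) -> sat eq rel rho phi.
Proof.
elim=> {G phi}.
- by move=> G phi Gphi rho; apply.
- by move=> G phi psi _ IH rho HG /= Hphi; apply: IH => chi [<-|/HG].
- by move=> G phi psi _ IH1 _ IH2 rho HG; apply: IH1 (IH2 rho HG).
- move=> G phi _ IH rho HG; apply: contrapT => nphi.
  by apply: (IH rho) => chi [<-|/HG].
- move=> G phi _ IH rho HG d; apply: IH => chi /List.in_map_iff[psi [<- /HG]].
  by move=> Hpsi; apply/sat_rename.
- by move=> G phi x _ IH rho HG; apply/sat_subst0; apply: IH.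
- by [].
- move=> G phi x y _ IH1 _ IH2 rho HG; apply/sat_subst0.
  by rewrite -(IH1 rho HG : rho x = rho y); apply/sat_subst0; apply: IH2.
Qed.

(** Domains with decidable equality let finite sets be counted by duplicate-free lists; the term
    model built below is of this kind. *)
Definition entails (Sg : signature) (T : theory Sg) phi := forall (D : eqType)
    (rel : sym Sg -> seq D -> Prop) (rho : nat -> D),
  (forall psi, T psi -> sat eq rel rho psi) -> sat eq rel rho phi.

Lemma proves_entails Sg (T : theory Sg) phi : proves T phi -> entails T phi.
Proof.
by move=> [G [GT d]] D rel rho HT; apply: (soundness d) => psi /GT/HT.
Qed.

(** * Henkin's construction of a term model *)

Section Henkin.
Variable Sg : signature.
Implicit Types (U : theory Sg) (phi psi chi : form Sg).

(** Turns the witness [c] into the variable about to be bound and shifts all others, which is the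
    form that [nd_allI] expects. *)
Definition unfresh c i := if i == c then 0 else i.+1.

(** If the new axiom were inconsistent, [U] would prove [psi] at [c]; as [c] does not occur in the
    axioms used, renaming by [unfresh] generalizes this to [All psi], which [U] refutes. *)
Lemma witness_consistent U psi c :
  (forall chi, U chi -> rename (unfresh c) chi = shift chi) ->
  rename (unfresh c) (subst0 c psi) = psi -> proves U (Neg (All psi)) ->
  consistent U -> consistent (extend U (Neg (subst0 c psi))).
Proof.
move=> Uc psic UN conU /proves_raa[G [GU d]]; apply: conU.
apply: (proves_impE UN); exists G; split=> //; apply: nd_allI.
have := nd_rename (unfresh c) d; rewrite psic; congr nd.
elim: G GU {d} => //= chi G IH GU; rewrite Uc ?IH //; last by apply: GU; left.
by move=> xi xiG; apply: GU; right.
Qed.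

Variables (enum : nat -> form Sg) (enum_surj : forall phi, exists n, enum n = phi).
Variable T : theory Sg.

(* Doubling all variables of T frees the odd ones to serve as witnesses. *)
Definition doubled : theory Sg := fun chi => exists2 psi, T psi & chi = rename double psi.

Hypothesis con : consistent doubled.

Lemma common_bound (G : seq (form Sg)) :
  exists n, forall psi, List.In psi G -> bounded n psi.
Proof.
elim: G => [|chi G [n IH]]; first by exists 0.
have [m b] := bounded_exists chi; exists (maxn m n) => psi [<-|/IH].
  exact: bounded_leq (leq_maxl _ _) b.
exact/bounded_leq/leq_maxr.
Qed.

(** Being odd it avoids the doubled theory, and being above the common bound it avoids the list
    [G]. *)
Definition fresh (G : seq (form Sg)) := (sval (cid (common_bound G))).*2.+1.

Definition witness (G : seq (form Sg)) chi : seq (form Sg) :=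
  if chi is Imp (All psi) Bot then [:: Neg (subst0 (fresh (chi :: G)) psi)] else [::].

Definition with_list (G : seq (form Sg)) : theory Sg :=
  theory_union doubled (fun phi => List.In phi G).

(** Lindenbaum's extension and the choice of witnesses run together: an enumerated formula is added
    if consistent, and a negated universal one brings a counterexample along. *)
Fixpoint henkin n : seq (form Sg) :=
  if n is m.+1 then
    if pselect (consistent (with_list (enum m :: henkin m)))
    then witness (henkin m) (enum m) ++ enum m :: henkin m else henkin m
  else [::].

Lemma fresh_bound (G : seq (form Sg)) psi i :
  List.In psi G -> i >= fresh G -> bounded i psi.
Proof.
move=> Gpsi; rewrite /fresh; case: cid => n /= /(_ psi Gpsi) b ni.
by apply: bounded_leq b; apply: leq_trans ni; rewrite -addnn leqW // leq_addr.
Qed.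

Lemma with_list_cons phi G : with_list (phi :: G) = extend (with_list G) phi.
Proof.
apply/funext => psi; apply/propext.
by rewrite /with_list /extend /theory_union /=; tauto.
Qed.

Lemma henkin_consistent n : consistent (with_list (henkin n)).
Proof.
elim: n => [|n IH] /=; first by move=> /proves_mono H; apply/con/H => psi [|[]].
case: pselect => // conE; rewrite /witness.
case: (enum n) conE => // chi1 chi2; case: chi1 => // psi; case: chi2 => // conE /=.
rewrite with_list_cons; set G := _ :: henkin n in conE *.
have cb chi : List.In chi G -> bounded (fresh G) chi by move/fresh_bound; apply.
apply: witness_consistent => //.
(* Freshness of the witness: by the bound for formulas of the list, by parity for those of the
   doubled theory. *)
- move=> chi [[xi _ ->]|/cb b]; rewrite /shift; last first.
    by apply: rename_bounded b _ => i ic; rewrite /unfresh ltn_eqF.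
  rewrite !rename_comp; apply: rename_ext => i /=; rewrite /unfresh ifF //.
  by apply/eqP => /(congr1 odd); rewrite /fresh /= !odd_double.
- rewrite /subst0 rename_comp -[RHS]rename_id.
  have := cb _ (or_introl erefl); rewrite /= andbT => /rename_bounded; apply.
  by case=> [|i] /=; rewrite /unfresh ?eqxx // ltnS => /ltn_eqF ->.
- by apply: proves_hyp; right; left.
Qed.

Lemma henkin_mono m n phi : m <= n ->
  with_list (henkin m) phi -> with_list (henkin n) phi.
Proof.
move=> /subnK <-; elim: (n - m) => // k IH /IH; rewrite addSn /=.
case: pselect => [conE|conE] //= [Tphi|Hphi]; [by left|right].
by apply/List.in_app_iff; right; right.
Qed.

Definition limit : theory Sg := fun phi => exists n, with_list (henkin n) phi.

(** A derivation uses finitely many axioms, and the stages increase. *)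
Lemma limit_finite phi : proves limit phi -> exists n, proves (with_list (henkin n)) phi.
Proof.
move=> [G [GT d]].
suff [n Gn] : exists n, forall psi, List.In psi G -> with_list (henkin n) psi.
  by exists n, G.
elim: G GT {d} => [|chi G IH] GT; first by exists 0.
have [|n Gn] := IH; first by move=> psi psiG; apply: GT; right.
have [m Hm] := GT chi (or_introl erefl); exists (maxn m n) => psi [<-|/Gn].
  exact: henkin_mono (leq_maxl _ _) Hm.
exact/henkin_mono/leq_maxr.
Qed.

Lemma limit_consistent : consistent limit.
Proof. by move=> /limit_finite[n /henkin_consistent]. Qed.

Lemma limit_proves n phi : proves (with_list (henkin n)) phi -> proves limit phi.
Proof. by apply: proves_mono => psi; exists n. Qed.

Lemma limit_complete phi : ~ proves limit phi -> proves limit (Neg phi).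
Proof.
have [n En] := enum_surj phi => nphi.
have := pselect (consistent (with_list (enum n :: henkin n))); rewrite En.
case=> [conE|/contrapT].
  case: nphi; apply: proves_hyp; exists n.+1; right; rewrite /= En.
  by case: pselect => // ?; apply/List.in_app_iff; right; left.
by rewrite with_list_cons => /proves_impI /limit_proves.
Qed.

Lemma limit_Neg phi : proves limit (Neg phi) <-> ~ proves limit phi.
Proof.
split; last exact: limit_complete.
by move=> /proves_impE N /N /limit_consistent.
Qed.

Lemma limit_Imp phi psi :
  proves limit (Imp phi psi) <-> (proves limit phi -> proves limit psi).
Proof.
split=> [|H]; first exact: proves_impE.
have [/H Hpsi|/limit_Neg nphi] := pselect (proves limit phi); apply: proves_impI.
  by apply: proves_mono Hpsi; left.
apply/proves_exfalso/(@proves_impE _ _ phi); last by apply: proves_hyp; right.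
by apply: proves_mono nphi; left.
Qed.

Lemma limit_All psi :
  proves limit (All psi) <-> forall x, proves limit (subst0 x psi).
Proof.
split=> [H x|H]; first exact: proves_allE.
apply: contrapT => /limit_Neg N.
have [n En] := enum_surj (Neg (All psi)).
(* Were [Neg (All psi)] rejected at its stage, the limit would refute a formula that it proves;
   hence it was accepted together with a witness. *)
have [conE|/contrapT] := pselect (consistent (with_list (enum n :: henkin n))); last first.
  rewrite with_list_cons En => /proves_impI /limit_proves NN.
  exact/limit_consistent/(proves_impE NN).
suff /limit_Neg : proves limit (Neg (subst0 (fresh (enum n :: henkin n)) psi)) by apply.
apply: proves_hyp; exists n.+1; right => /=; case: pselect => // ?.
by apply/List.in_app_iff; left; rewrite /witness En /=; left.
Qed.

Lemma least_equal_exists x : exists n, `[< proves limit (Eq x n) >].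
Proof. by exists x; apply/asboolP/proves_eqI. Qed.

(** A normal form modulo provable equality: the domain of the term model becomes a subtype of [nat],
    and no quotient has to be formed. *)
Definition least_equal x := ex_minn (least_equal_exists x).

Lemma least_equalP x : proves limit (Eq x (least_equal x)).
Proof. by rewrite /least_equal; case: ex_minnP => n /asboolP. Qed.

Lemma least_equal_eq x y : least_equal x = least_equal y <-> proves limit (Eq x y).
Proof.
split=> [E|xy].
  apply: (proves_eq_trans (least_equalP x)); rewrite E.
  exact/proves_eq_sym/least_equalP.
rewrite /least_equal; apply: eq_ex_minn => n; apply/asboolP/asboolP => H.
  exact: proves_eq_trans (proves_eq_sym xy) H.
exact: proves_eq_trans xy H.
Qed.

Lemma least_equal_idem x : least_equal (least_equal x) == least_equal x.
Proof. by apply/eqP; apply/least_equal_eq/proves_eq_sym/least_equalP. Qed.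

Definition henkin_dom := {x : nat | least_equal x == x}.

Definition henkin_val (x : nat) : henkin_dom := exist _ (least_equal x) (least_equal_idem x).

Definition henkin_rel (r : sym Sg) (s : seq henkin_dom) : Prop :=
  exists2 v : (arity r).-tuple nat, s = map henkin_val v & proves limit (Rel r v).

Lemma henkin_val_eq x y : henkin_val x = henkin_val y <-> proves limit (Eq x y).
Proof.
by rewrite -least_equal_eq; split=> [[]|E] //; apply: val_inj.
Qed.

Lemma henkin_val_surj (d : henkin_dom) : exists x, d = henkin_val x.
Proof. by exists (val d); apply: val_inj; rewrite /= (eqP (valP d)). Qed.

(** The renaming [f] is kept general so that the induction can pass under a quantifier, where [f]
    becomes [scons x f]. *)
Lemma truth_lemma phi f :
  sat eq henkin_rel (henkin_val \o f) phi <-> proves limit (rename f phi).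
Proof.
elim: phi f => /= [|x y|r v|phi1 IH1 phi2 IH2|phi1 IH] f.
- by split=> // /limit_consistent.
- exact: henkin_val_eq.
- split=> [[w E]|H]; last by exists (map_tuple f v); rewrite //= -map_comp.
  apply: proves_rel => i; rewrite tnth_map; apply/henkin_val_eq.
  have /(congr1 (nth (henkin_val 0) ^~ i)) := E.
  by rewrite !(nth_map 0) ?size_tuple // /= -!tnth_nth => ->.
- by rewrite limit_Imp IH1 IH2.
- rewrite limit_All.
  have E x : scons (henkin_val x) (henkin_val \o f) = henkin_val \o scons x f.
    by apply/funext => -[].
  split=> [H x|H d]; first by rewrite subst0_up -IH -E.
  have [x ->] := henkin_val_surj d.
  by rewrite E IH -subst0_up.
Qed.

Lemma doubled_model :
  forall psi, T psi -> sat eq henkin_rel (henkin_val \o double) psi.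
Proof.
move=> psi Tpsi; apply/truth_lemma/proves_hyp; exists 0; left.
by exists psi.
Qed.

End Henkin.

(** Halving all variables turns a refutation of the doubled theory into one of [T]. *)
Lemma consistent_doubled Sg (T : theory Sg) : consistent T -> consistent (doubled T).
Proof.
move=> con [G [GT d]]; apply: con; exists (map (rename half) G); split.
  move=> _ /List.in_map_iff[_ [<- /GT[psi Tpsi ->]]].
  rewrite rename_comp (@rename_ext _ _ id) ?rename_id // => i /=.
  by rewrite doubleK.
exact: nd_rename d.
Qed.

(** An unproved [phi] fails in the term model of [T] with [Neg phi], under the assignment sending
    each variable [x] to the class of its double. *)
Theorem completeness (Sg : signature) (enum : nat -> form Sg) (T : theory Sg) phi :
  (forall psi, exists n, enum n = psi) -> entails T phi -> proves T phi.
Proof.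
move=> enum_surj ent; apply: contrapT => nphi.
have con : consistent (doubled (extend T (Neg phi))).
  by apply: consistent_doubled => /proves_raa.
have M := doubled_model enum_surj con.
apply: (M (Neg phi)); first by right.
by apply: ent => psi Tpsi; apply: M; left.
Qed.

(** * The translation *)

Section Connectives.
Variables (Sg : signature) (D : Type) (eqv : D -> D -> Prop).
Variables (rel : sym Sg -> seq D -> Prop) (rho : nat -> D).
Implicit Types (phi psi : form Sg) (P Q : Prop).

Lemma sat_Imp phi psi P Q : (sat eqv rel rho phi <-> P) ->
  (sat eqv rel rho psi <-> Q) -> (sat eqv rel rho (Imp phi psi) <-> (P -> Q)).
Proof. by move=> /= -> ->. Qed.

Lemma sat_Neg phi P : (sat eqv rel rho phi <-> P) ->
  (sat eqv rel rho (Neg phi) <-> ~ P).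
Proof. by move=> /= ->. Qed.

Lemma sat_And phi psi P Q : (sat eqv rel rho phi <-> P) ->
  (sat eqv rel rho psi <-> Q) -> (sat eqv rel rho (And phi psi) <-> P /\ Q).
Proof. by move=> /= -> ->; case: (EM P); case: (EM Q); tauto. Qed.

Lemma sat_Or phi psi P Q : (sat eqv rel rho phi <-> P) ->
  (sat eqv rel rho psi <-> Q) -> (sat eqv rel rho (Or phi psi) <-> P \/ Q).
Proof. by move=> /= -> ->; case: (EM P); tauto. Qed.

Lemma sat_Iff phi psi P Q : (sat eqv rel rho phi <-> P) ->
  (sat eqv rel rho psi <-> Q) -> (sat eqv rel rho (Iff phi psi) <-> (P <-> Q)).
Proof. by move=> Hp Hq; rewrite /iff; apply: sat_And; apply: sat_Imp. Qed.

Lemma sat_All phi (P : D -> Prop) :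
  (forall d, sat eqv rel (scons d rho) phi <-> P d) ->
  (sat eqv rel rho (All phi) <-> forall d, P d).
Proof. by move=> H; split=> K d; apply/H/K. Qed.

Lemma sat_Ex phi (P : D -> Prop) :
  (forall d, sat eqv rel (scons d rho) phi <-> P d) ->
  (sat eqv rel rho (Ex phi) <-> exists d, P d).
Proof.
move=> H; split=> [K|[d /H Pd]]; last by move=> /= /(_ d); apply.
by apply: contrapT => N; apply: K => d /H Pd; apply: N; exists d.
Qed.

Lemma sat_plug phi v P : (sat eqv rel (fun i => rho (nth 0 v i)) phi <-> P) ->
  (sat eqv rel rho (plug phi v) <-> P).
Proof. by move=> <-; apply: sat_rename. Qed.

End Connectives.

Lemma sat_BigOr (Sg : signature) D (eqv : D -> D -> Prop)
    (rel : sym Sg -> seq D -> Prop) rho (I : eqType) (F : I -> form Sg) (P : I -> Prop) s :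
  (forall i, i \in s -> sat eqv rel rho (F i) <-> P i) ->
  (sat eqv rel rho (BigOr [seq F i | i <- s]) <-> exists2 i, i \in s & P i).
Proof.
elim: s => [|i s IH] H; first by split=> [|[]].
have {}IH := IH (fun j js => H j (mem_behead (s := i :: s) js)).
rewrite [X in X <-> _](sat_Or (H i (mem_head _ _)) IH); split.
  case=> [Pi|[j js Pj]]; first by exists i; rewrite ?mem_head.
  by exists j => //; rewrite inE js orbT.
by case=> j; rewrite inE => /predU1P[->|js] Pj; [left|right; exists j].
Qed.

(** The head of the list is the value of variable 0, so its last entry belongs to the outermost
    quantifier. *)
Lemma sat_Alls (Sg : signature) D (eqv : D -> D -> Prop)
    (rel : sym Sg -> seq D -> Prop) rho n (phi : form Sg) :
  sat eqv rel rho (Alls n phi) <->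
  forall s : seq D, size s = n -> sat eqv rel (foldr (@scons D) rho s) phi.
Proof.
elim: n rho => [|n IH] rho.
  by split=> [H s /size0nil -> //|/(_ [::] erefl)].
rewrite /Alls iterS -/(Alls n phi) /=; split=> [H s|H d].
  by case/lastP: s => // s d; rewrite size_rcons foldr_rcons => -[] sn; apply: (IH _).1 sn.
by apply/IH => s sn; rewrite -foldr_rcons; apply: H; rewrite size_rcons sn.
Qed.

(* Proves that satisfaction of a concrete formula unfolds as expected, [leaf]
   handling the plugged formulas. *)
Ltac unfold_sat leaf :=
  lazymatch goal with
  | |- sat _ _ _ (Iff _ _) <-> _ => apply: sat_Iff; unfold_sat leaf
  | |- sat _ _ _ (And _ _) <-> _ => apply: sat_And; unfold_sat leaf
  | |- sat _ _ _ (Or _ _) <-> _ => apply: sat_Or; unfold_sat leaf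
  | |- sat _ _ _ (Neg _) <-> _ => apply: sat_Neg; unfold_sat leaf
  | |- sat _ _ _ (Imp _ _) <-> _ => apply: sat_Imp; unfold_sat leaf
  | |- sat _ _ _ (Ex _) <-> _ => apply: sat_Ex => ?; unfold_sat leaf
  | |- sat _ _ _ (All _) <-> _ => apply: sat_All => ?; unfold_sat leaf
  | |- sat _ _ _ (Alls _ _) <-> _ => cbn [Alls iter]; unfold_sat leaf
  | |- sat _ _ _ (plug _ _) <-> _ => apply: sat_plug; leaf
  | |- _ => by []
  end.

(** * Set-theoretic formulas for cardinal arithmetic *)

Definition emp_form : form set_sig := All (Neg (in_ 0 1)).

Definition pairset_form : form set_sig :=
  All (Iff (in_ 0 1) (Or (Eq 0 2) (Eq 0 3))).

Definition opair_form : form set_sig :=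
  Ex (Ex (And (plug pairset_form [:: 2; 1; 0])
         (And (plug pairset_form [:: 1; 3; 3]) (plug pairset_form [:: 0; 3; 4])))).

Definition app_form : form set_sig :=
  Ex (And (in_ 0 1) (plug opair_form [:: 0; 2; 3])).

Definition bij_form : form set_sig :=
  Ex (And (All (Imp (in_ 0 2) (Ex (And (in_ 0 4) (plug app_form [:: 2; 1; 0])))))
     (And (All (Imp (in_ 0 3) (Ex (And (in_ 0 3) (plug app_form [:: 2; 0; 1])))))
          (Alls 4 (Imp (in_ 3 5) (Imp (in_ 2 5) (Imp (in_ 1 6) (Imp (in_ 0 6)
             (Imp (plug app_form [:: 4; 3; 1]) (Imp (plug app_form [:: 4; 2; 0])
                (Iff (Eq 3 2) (Eq 1 0))))))))))).

Definition sim_form : form set_sig :=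
  All (Iff (plug bij_form [:: 1; 0]) (plug bij_form [:: 2; 0])).

Definition saturate_form (phi : form set_sig) : form set_sig :=
  Ex (Ex (Ex (And (plug sim_form [:: 3; 2]) (And (plug sim_form [:: 4; 1])
    (And (plug sim_form [:: 5; 0]) (plug phi [:: 2; 1; 0])))))).

Definition functional_form (phi : form set_sig) : form set_sig :=
  And (Ex (plug phi [:: 1; 2; 0]))
      (Alls 2 (Imp (plug phi [:: 2; 3; 1]) (Imp (plug phi [:: 2; 3; 0])
                   (plug sim_form [:: 1; 0])))).

Definition function_form (phi : form set_sig) : form set_sig :=
  Or (And (plug (functional_form phi) [:: 0; 1]) (plug phi [:: 0; 1; 2]))
     (And (Neg (plug (functional_form phi) [:: 0; 1])) (plug sim_form [:: 0; 2])).

(* The second argument place is a dummy. *)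
Definition succ_form : form set_sig :=
  Ex (And (Neg (in_ 0 1)) (All (Iff (in_ 0 4) (Or (in_ 0 2) (Eq 0 1))))).

Definition add_form : form set_sig :=
  And (All (Imp (in_ 0 1) (Neg (in_ 0 2))))
      (All (Iff (in_ 0 3) (Or (in_ 0 1) (in_ 0 2)))).

Definition mul_form : form set_sig :=
  And (All (Imp (in_ 0 3) (Ex (Ex (And (in_ 1 3) (And (in_ 0 4)
                                    (plug opair_form [:: 2; 1; 0])))))))
      (Alls 2 (Imp (in_ 1 2) (Imp (in_ 0 3)
        (Ex (And (in_ 0 5) (And (plug opair_form [:: 0; 2; 1])
          (All (Imp (in_ 0 6) (Imp (plug opair_form [:: 0; 3; 2]) (Eq 0 1)))))))))).

Definition le_form : form set_sig :=
  Ex (Ex (And (plug sim_form [:: 2; 1]) (And (plug sim_form [:: 3; 0])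
    (All (Imp (in_ 0 2) (in_ 0 1)))))).

Definition p_form : form set_sig :=
  And (Ex (plug emp_form [:: 0]))
  (And (Alls 2 (Ex (plug pairset_form [:: 0; 2; 1])))
       (All (Imp (plug sim_form [:: 1; 0])
         (All (Ex (All (Iff (in_ 0 1) (Or (in_ 0 3) (Eq 0 2))))))))).

Definition ap_form (r : ap_sym) : form set_sig :=
  match r with
  | ZeroG => emp_form
  | SuccG => plug (function_form (saturate_form succ_form)) [:: 0; 0; 1]
  | AddG => function_form (saturate_form add_form)
  | MulG => function_form (saturate_form mul_form)
  | LeS => le_form
  | PS => p_form
  end.

Lemma ap_form_bounded (r : sym ap_sig) : bounded (arity r) (ap_form r).
Proof. by case: r; vm_compute. Qed.

(* A number is a set, identified with the sets of the same cardinality; every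
   set is in the domain. *)
Definition card_translation : translation ap_sig set_sig :=
  @Translation ap_sig set_sig (Eq 0 0) sim_form ap_form erefl erefl ap_form_bounded.

(** * The relations that these formulas define in a structure *)

Section SetSemantics.
Variables (D : Type) (E : D -> D -> Prop).
Implicit Types (x y z w a b p f : D).

Definition emp x := forall y, ~ E y x.

Definition pairset z a b := forall y, E y z <-> y = a \/ y = b.

(** Kuratowski's pair; without extensionality the same [a] and [b] may have many pairs. *)
Definition opair p a b :=
  exists u v, pairset p u v /\ pairset u a a /\ pairset v a b.

Definition app f a b := exists p, E p f /\ opair p a b.

(** Only the trace of [f] between [x] and [y] matters; [f] may have further members. The last clause
    states single-valuedness and injectivity at once. *)
Definition bij x y := exists f,
  (forall a, E a x -> exists b, E b y /\ app f a b) /\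
  (forall b, E b y -> exists a, E a x /\ app f a b) /\
  (forall a a' b b', E a x -> E a' x -> E b y -> E b' y ->
     app f a b -> app f a' b' -> (a = a' <-> b = b')).

(* An equivalence relation in any structure, whether or not bijections compose. *)
Definition sim x y := forall z, bij x z <-> bij y z.

(** Makes the relation invariant under [sim]; addition can thus pass to disjoint representatives of
    its arguments. *)
Definition saturate (A : D -> D -> D -> Prop) x y z := exists x' y' z',
  sim x x' /\ sim y y' /\ sim z z' /\ A x' y' z'.

Definition functional (A : D -> D -> D -> Prop) x y :=
  (exists z, A x y z) /\ (forall z z', A x y z -> A x y z' -> sim z z').

(* Made total and single-valued up to [sim] by taking x as the default value. *)
Definition function (A : D -> D -> D -> Prop) x y z :=
  (functional A x y /\ A x y z) \/ (~ functional A x y /\ sim x z).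

Definition succ_rel x (_ : D) z :=
  exists y, ~ E y x /\ forall w, E w z <-> E w x \/ w = y.

Definition add_rel x y z :=
  (forall w, E w x -> ~ E w y) /\ (forall w, E w z <-> E w x \/ E w y).

(** A cartesian product holding exactly one of the possibly many pairs of each [a] and [b], so that
    the count comes out right. *)
Definition mul_rel x y z :=
  (forall p, E p z -> exists a b, E a x /\ E b y /\ opair p a b) /\
  (forall a b, E a x -> E b y -> exists p, E p z /\ opair p a b /\
     forall p', E p' z -> opair p' a b -> p' = p).

Definition card_le x y := exists x' y',
  sim x x' /\ sim y y' /\ forall w, E w x' -> E w y'.

(** Quantifying over all [x'] with [sim x x'] makes the predicate respect the interpreted
    identity. *)
Definition adjoinable x := (exists e, emp e) /\
  (forall a b, exists z, pairset z a b) /\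
  (forall x', sim x x' -> forall y, exists z, forall w, E w z <-> E w x' \/ w = y).

(** [False] is a default value: atomic formulas only ever supply two entries. *)
Definition set_rel (r : sym set_sig) (s : seq D) : Prop :=
  if s is [:: x; y] then E x y else False.

Definition ap_rel (r : sym ap_sig) (s : seq D) : Prop :=
  match r, s with
  | ZeroG, [:: x] => emp x
  | SuccG, [:: x; z] => function (saturate succ_rel) x x z
  | AddG, [:: x; y; z] => function (saturate add_rel) x y z
  | MulG, [:: x; y; z] => function (saturate mul_rel) x y z
  | LeS, [:: x; y] => card_le x y
  | PS, [:: x] => adjoinable x
  | _, _ => False
  end.

Local Notation ssat := (sat (Sg := set_sig) eq set_rel).

Lemma sat_emp rho : ssat rho emp_form <-> emp (rho 0).
Proof. by rewrite /emp_form; unfold_sat idtac. Qed.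

Lemma sat_pairset rho : ssat rho pairset_form <-> pairset (rho 0) (rho 1) (rho 2).
Proof. by rewrite /pairset_form; unfold_sat idtac. Qed.

Lemma sat_opair rho : ssat rho opair_form <-> opair (rho 0) (rho 1) (rho 2).
Proof. by rewrite /opair_form; unfold_sat ltac:(exact: sat_pairset). Qed.

Lemma sat_app rho : ssat rho app_form <-> app (rho 0) (rho 1) (rho 2).
Proof. by rewrite /app_form; unfold_sat ltac:(exact: sat_opair). Qed.

Lemma sat_bij rho : ssat rho bij_form <-> bij (rho 0) (rho 1).
Proof. by rewrite /bij_form; unfold_sat ltac:(exact: sat_app). Qed.

Lemma sat_sim rho : ssat rho sim_form <-> sim (rho 0) (rho 1).
Proof. by rewrite /sim_form; unfold_sat ltac:(exact: sat_bij). Qed.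

Section Ternary.
Variables (phi : form set_sig) (A : D -> D -> D -> Prop).
Hypothesis sat_phi : forall rho, ssat rho phi <-> A (rho 0) (rho 1) (rho 2).

Lemma sat_saturate rho :
  ssat rho (saturate_form phi) <-> saturate A (rho 0) (rho 1) (rho 2).
Proof. by rewrite /saturate_form; unfold_sat ltac:(first [exact: sat_sim | exact: sat_phi]). Qed.

Lemma sat_functional rho :
  ssat rho (functional_form phi) <-> functional A (rho 0) (rho 1).
Proof.
by rewrite /functional_form; unfold_sat ltac:(first [exact: sat_sim | exact: sat_phi]).
Qed.

Lemma sat_function rho :
  ssat rho (function_form phi) <-> function A (rho 0) (rho 1) (rho 2).
Proof.
by rewrite /function_form; unfold_sat ltac:(first [exact: sat_sim | exact: sat_functional | exact: sat_phi]).
Qed.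

End Ternary.

Lemma sat_succ rho : ssat rho succ_form <-> succ_rel (rho 0) (rho 1) (rho 2).
Proof. by rewrite /succ_form; unfold_sat idtac. Qed.

Lemma sat_add rho : ssat rho add_form <-> add_rel (rho 0) (rho 1) (rho 2).
Proof. by rewrite /add_form; unfold_sat idtac. Qed.

Lemma sat_mul rho : ssat rho mul_form <-> mul_rel (rho 0) (rho 1) (rho 2).
Proof. by rewrite /mul_form; unfold_sat ltac:(exact: sat_opair). Qed.

Lemma sat_le rho : ssat rho le_form <-> card_le (rho 0) (rho 1).
Proof. by rewrite /le_form; unfold_sat ltac:(exact: sat_sim). Qed.

Lemma sat_p rho : ssat rho p_form <-> adjoinable (rho 0).
Proof.
by rewrite /p_form; unfold_sat ltac:(first [exact: sat_emp | exact: sat_pairset | exact: sat_sim]).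
Qed.

(** Every structure for membership carries an internal arithmetical structure on the same domain,
    with [sim] as identity; translated formulas speak about it. *)
Lemma sat_translate rho (phi : form ap_sig) :
  ssat rho (translate card_translation phi) <-> sat sim ap_rel rho phi.
Proof.
elim: phi rho => [|x y|r v|phi1 IH1 phi2 IH2|phi1 IH] rho.
- by [].
- by apply: sat_plug; apply: sat_sim.
- apply: sat_plug; case: r v => -[[|x [|y [|z [|w s]]]] vr]; try discriminate vr.
  + exact: sat_emp.
  + by apply: sat_plug; apply: (sat_function (sat_saturate sat_succ)).
  + exact: (sat_function (sat_saturate sat_add)).
  + exact: (sat_function (sat_saturate sat_mul)).
  + exact: sat_le.
  + exact: sat_p.
- exact: sat_Imp.
- by apply: sat_All => d; split=> [H|/IH H ?//]; apply/IH/H.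
Qed.

Lemma sat_VS_axiom rho n : ssat rho (VS_axiom n) <->
  forall s : seq D, size s = n -> exists z, forall y, E y z <-> List.In y s.
Proof.
have E1 s : size s = n -> ssat (foldr (@scons D) rho s)
     (Ex (All (Iff (in_ 0 1) (BigOr [seq Eq 0 i.+2 | i <- iota 0 n])))) <->
   exists z, forall y, E y z <-> List.In y s.
  move=> sn; apply: sat_Ex => z; apply: sat_All => y; apply: sat_Iff => //.
  rewrite (sat_BigOr (P := fun i => y = foldr (@scons D) rho s i)) //; split.
    case=> i; rewrite mem_iota /= add0n -sn => si ->.
    elim: s i si {sn} => // d s IH [|i] /=; first by left.
    by move=> /IH; right.
  rewrite -sn => ys.
  suff [i si ->] : exists2 i, i < size s & y = foldr (@scons D) rho s i.
    by exists i; rewrite // mem_iota.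
  elim: s ys {sn} => //= d s IH [->|/IH[i si ->]]; first by exists 0.
  by exists i.+1.
rewrite /VS_axiom; split=> [/sat_Alls H s sn|H]; first exact/(E1 _ sn)/H.
by apply/sat_Alls => s sn; apply/(E1 _ sn)/H.
Qed.

End SetSemantics.

(** * Cardinalities *)

Lemma In_mem (T : eqType) (x : T) s : List.In x s <-> x \in s.
Proof.
elim: s => //= y s IH; rewrite inE IH eq_sym.
by split=> [[->|->]|/predU1P[|]]; rewrite ?eqxx ?orbT; auto.
Qed.

(** * The identity axioms for the interpreted arithmetic *)

Section Congruence.
Variables (D : Type) (E : D -> D -> Prop).
Implicit Types (x y z : D) (A : D -> D -> D -> Prop).

Lemma sim_refl x : sim E x x.
Proof. by []. Qed.

Lemma sim_sym x y : sim E x y -> sim E y x.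
Proof. by move=> xy z; rewrite xy. Qed.

Lemma sim_trans y x z : sim E x y -> sim E y z -> sim E x z.
Proof. by move=> xy yz w; rewrite xy. Qed.

Lemma saturate_sim A x y z x1 y1 z1 : sim E x x1 -> sim E y y1 -> sim E z z1 ->
  saturate E A x y z -> saturate E A x1 y1 z1.
Proof.
move=> xx yy zz [x' [y' [z' [xx' [yy' [zz' H]]]]]]; exists x', y', z'.
by split; [|split; [|split]] => //; [move: xx'|move: yy'|move: zz'];
  apply: sim_trans; apply: sim_sym.
Qed.

Lemma functional_sim A x y x1 y1 : sim E x x1 -> sim E y y1 ->
  functional E (saturate E A) x y -> functional E (saturate E A) x1 y1.
Proof.
move=> xx yy [[z Hz] H]; split; first by exists z; apply: saturate_sim Hz.
by move=> z1 z2 H1 H2; apply: H; [move: H1|move: H2];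
  apply: saturate_sim => //; apply: sim_sym.
Qed.

Lemma function_sim A x y z x1 y1 z1 : sim E x x1 -> sim E y y1 -> sim E z z1 ->
  function E (saturate E A) x y z -> function E (saturate E A) x1 y1 z1.
Proof.
move=> xx yy zz [[F H]|[F H]]; [left|right]; split.
- exact: functional_sim F.
- exact: saturate_sim H.
- by move=> F1; apply: F; apply: functional_sim F1; apply: sim_sym.
- exact: sim_trans (sim_trans (sim_sym xx) H) zz.
Qed.

Lemma function_total A x y : exists z, function E A x y z.
Proof.
have [F|F] := EM (functional E A x y); last by exists x; right.
by have [[z Hz] _] := F; exists z; left.
Qed.

Lemma function_unique A x y z z1 :
  function E A x y z -> function E A x y z1 -> sim E z z1.
Proof.
move=> [[F H]|[F H]] [[F1 H1]|[F1 H1]] //; first exact: F.2.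
exact: sim_trans (sim_sym H) H1.
Qed.

(** All clauses are vacuous, so any element can serve as the bijection, for instance [x]. *)
Lemma bij_emp x : emp E x -> bij E x x.
Proof. by move=> ex; exists x; split=> [a /ex|]//; split=> [a /ex|a a' b b' /ex]. Qed.

Lemma emp_sim x y : emp E x -> emp E y -> sim E x y.
Proof.
have H x1 y1 z : emp E x1 -> emp E y1 -> bij E x1 z -> bij E y1 z.
  move=> ex1 ey1 [f [_ [H _]]]; exists f; split=> [a /ey1 //|].
  by split=> [b /H[a [/ex1]]|a a' b b' /ey1].
by move=> ex ey z; split; apply: H.
Qed.

(** Instantiating [sim] at [x] itself yields a bijection from [y] to [x], and a member of [y] would
    need a partner in [x]. *)
Lemma sim_emp x y : sim E x y -> emp E x -> emp E y.
Proof.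
by move=> xy ex; have [f [H _]] := (xy x).1 (bij_emp ex) => a /H[b [/ex]].
Qed.

Lemma card_le_sim x y x1 y1 : sim E x x1 -> sim E y y1 ->
  card_le E x y -> card_le E x1 y1.
Proof.
move=> xx yy [x' [y' [xx' [yy' H]]]]; exists x', y'.
by split; [|split] => //; [move: xx'|move: yy']; apply: sim_trans; apply: sim_sym.
Qed.

Lemma adjoinable_sim x x1 : sim E x x1 -> adjoinable E x -> adjoinable E x1.
Proof.
by move=> xx [H0 [H1 H]]; split=> //; split=> // x' /(sim_trans xx); apply: H.
Qed.

Lemma ap_rel_sim (r : sym ap_sig) (f g : nat -> D) :
  (forall i, i < arity r -> sim E (f i) (g i)) ->
  ap_rel E r (map f (iota 0 (arity r))) -> ap_rel E r (map g (iota 0 (arity r))).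
Proof.
case: r => /= fg.
- exact/sim_emp/fg.
- by apply: function_sim; apply: fg.
- by apply: function_sim; apply: fg.
- by apply: function_sim; apply: fg.
- by apply: card_le_sim; apply: fg.
- exact/adjoinable_sim/fg.
Qed.

Lemma sat_foldr_Imp (Sg : signature) (eqv : D -> D -> Prop)
    (rel : sym Sg -> seq D -> Prop) rho (phi : form Sg) s :
  ((forall psi, List.In psi s -> sat eqv rel rho psi) -> sat eqv rel rho phi) ->
  sat eqv rel rho (foldr (@Imp Sg) phi s).
Proof.
elim: s => [|psi s IH] H /=; first by apply: H.
by move=> Hpsi; apply: IH => Hs; apply: H => chi [<-|/Hs].
Qed.

Lemma map_mktuple (f : nat -> D) (g : nat -> nat) n :
  map f [tuple g (val i) | i < n] = map (f \o g) (iota 0 n).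
Proof. by rewrite /= -map_comp -[in RHS]val_enum_ord -map_comp. Qed.

(** Totality and uniqueness of the graphs are built into [function]; only the constant zero needs a
    set to exist. *)
Lemma sat_id_ap (rho : nat -> D) (phi : form ap_sig) :
  (exists e, emp E e) -> id_ap phi -> sat (sim E) (ap_rel E) rho phi.
Proof.
move=> [e He] [{}phi [|||r]||||||||].
- by move=> d.
- by intros d1 d2; apply: sim_sym.
- by intros d1 d2 d3; apply: sim_trans.
- apply/sat_Alls => s _; apply: sat_foldr_Imp => H.
  rewrite [sat _ _ _ _]/= (map_mktuple _ id) (map_mktuple _ (addn (arity r))).
  apply: ap_rel_sim => i ir; apply: (H (Eq i (arity r + i))).
  by apply/List.in_map/In_mem; rewrite mem_iota.
- by apply/sat_Ex; [move=> ?; apply: iff_refl|exists e].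
- by intros y x; apply: emp_sim.
- intros x; apply/sat_Ex; first by move=> ?; apply: iff_refl.
  exact: function_total.
- by intros x y z; apply: function_unique.
- intros x y; apply/sat_Ex; first by move=> ?; apply: iff_refl.
  exact: function_total.
- by intros x y z w; apply: function_unique.
- intros x y; apply/sat_Ex; first by move=> ?; apply: iff_refl.
  exact: function_total.
- by intros x y z w; apply: function_unique.
Qed.

End Congruence.

(** * Finite cardinals in structures with enough finite sets *)

Section Cardinality.
Variables (D : eqType) (E : D -> D -> Prop).
Implicit Types (x y z a b p : D) (s t : seq D) (m n : nat).

Definition lists x s := forall y, E y x <-> y \in s.

Definition card n x := exists s, [/\ uniq s, size s = n & lists x s].

(** The axioms of [VS] up to [n]. The lemmas below record how much of this they use, since it
    becomes available only step by step on the arithmetical side. *)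
Definition full n := forall s, size s <= n -> exists z, lists z s.

Lemma full_leq m n : m <= n -> full n -> full m.
Proof. by move=> mn Fn s sm; apply: Fn; apply: leq_trans mn. Qed.

Lemma card_inj m n x : card m x -> card n x -> m = n.
Proof.
move=> [s [us <- xs]] [t [ut <- xt]]; apply: perm_size.
by apply: uniq_perm => // y; apply/idP/idP => /= [/xs/xt|/xt/xs].
Qed.

Lemma card0 x : card 0 x <-> emp E x.
Proof.
split=> [[s [_ /size0nil -> xs]] y /xs //|ex].
by exists [::]; split=> // y; split=> // /ex.
Qed.

(* Russell's paradox: the set of y in s that are not in themselves is not in s. *)
Lemma fresh_element s : full (size s) -> exists y, y \notin s.
Proof.
move=> F; have [|z zs] := F [seq y <- s | `[< ~ E y y >]].
  by rewrite size_filter count_size.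
exists z; apply/negP => s_z; have := zs z; rewrite mem_filter s_z andbT.
by have [zz|zz] := EM (E z z) => -[H1 H2];
   [have /asboolP := H1 zz|apply/zz/H2/asboolP].
Qed.

Lemma uniq_exists n : full n -> exists2 s : seq D, uniq s & size s = n.
Proof.
elim: n => [|n IH] F; first by exists [::].
have [s us sn] := IH (full_leq (leqnSn n) F).
have [y ys] : exists y, y \notin s.
  by apply: fresh_element; rewrite sn; apply: full_leq F.
by exists (y :: s); rewrite /= ?ys ?sn.
Qed.

Lemma card_exists n : full n -> exists x, card n x.
Proof.
move=> F; have [s us sn] := uniq_exists F.
by have [x xs] := F s (eq_leq sn); exists x, s.
Qed.

(** Kuratowski's argument survives without extensionality, because the members of [p] are literally
    [u] and [v]. *)
Lemma opair_inj p a b a' b' : opair E p a b -> opair E p a' b' -> a = a' /\ b = b'.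
Proof.
move=> [u [v [Hp [Hu Hv]]]] [u' [v' [Hp' [Hu' Hv']]]].
have aa : a = a'.
  have /Hp[uu|uv] : E u' p by apply/Hp'; left.
    have /Hu : E a' u by rewrite -uu; apply/Hu'; left.
    by case.
  have /Hu' : E a u' by rewrite uv; apply/Hv; left.
  by case.
split=> //; rewrite -{a'}aa in Hu' Hv'.
have bu' : E b u' -> b = a by case/Hu'.
have b'u : E b' u -> b' = a by case/Hu.
have bv : E b v by apply/Hv; right.
have b'v' : E b' v' by apply/Hv'; right.
have /Hp'[vu|vv] : E v p by apply/Hp; right.
  have ba : b = a by apply: bu'; rewrite -vu.
  have /Hp[vu'|vv'] : E v' p by apply/Hp'; right.
    by rewrite ba b'u // -vu'.
  by move: b'v'; rewrite vv' => /Hv; rewrite ba; case.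
move: (bv); rewrite vv => /Hv'[ba|//].
by move: b'v'; rewrite -vv => /Hv[->|].
Qed.

(** Stated for any relation, so that [card_bij] can apply it to a bijection and to its converse. *)
Lemma card_correspondence (R : D -> D -> Prop) n x y :
  (forall a, E a x -> exists b, E b y /\ R a b) ->
  (forall b, E b y -> exists a, E a x /\ R a b) ->
  (forall a a' b b', E a x -> E a' x -> E b y -> E b' y ->
     R a b -> R a' b' -> (a = a' <-> b = b')) ->
  card n x -> card n y.
Proof.
move=> R1 R2 R3 [s [us <- xs]].
have /choice[g Hg] : forall a, exists b, E a x -> E b y /\ R a b.
  (* Outside [x] the chosen function takes the default value [a]. *)
  move=> a; have [/R1[b Hb]|nx] := EM (E a x); first by exists b.
  by exists a.
exists (map g s); split; rewrite ?size_map //.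
  rewrite map_inj_in_uniq // => a a' /xs ax /xs a'x gaa'.
  have [[yga Ra] [yga' Ra']] := (Hg a ax, Hg a' a'x).
  exact/(R3 _ _ _ _ ax a'x yga yga' Ra Ra').
move=> b; split=> [yb|/mapP[a /xs ax ->]]; last by case: (Hg a ax).
have [a [ax Rab]] := R2 b yb; have [yga Rga] := Hg a ax.
by apply/mapP; exists a; [apply/xs|apply/(R3 _ _ _ _ ax ax yb yga Rab Rga)].
Qed.

Lemma card_bij n x y : bij E x y -> card n x <-> card n y.
Proof.
move=> [f [H1 [H2 H3]]]; split; first exact: (card_correspondence (R := app E f)).
apply: (card_correspondence (R := fun b a => app E f a b)) => //.
by move=> b b' a a' yb yb' xa xa' fab fab'; split=> /(H3 _ _ _ _ xa xa' yb yb' fab fab').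
Qed.

Section Pairs.
Hypothesis pairs : forall a b, exists z, pairset E z a b.

Lemma opair_exists : exists c : D -> D -> D, forall a b, opair E (c a b) a b.
Proof.
suff H a b : exists p, opair E p a b.
  have /choice[c Hc] : forall ab : D * D, exists p, opair E p ab.1 ab.2 by [].
  by exists (fun a b => c (a, b)) => a b; apply: (Hc (a, b)).
have [u Hu] := pairs a a; have [v Hv] := pairs a b; have [p Hp] := pairs u v.
by exists p, u, v.
Qed.

Lemma bij_card n x y : full n -> card n x -> card n y -> bij E x y.
Proof.
move=> F [s [us sn xs]] [t [ut tn yt]]; have [c Hc] := opair_exists.
(* The graph of a bijection between [n]-element sets has only [n] pairs, so [full n] already
   provides it. *)
have [|f Hf] := F [seq c ab.1 ab.2 | ab <- zip s t].
  by rewrite size_map size_zip sn tn minnn.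
have appE a b : app E f a b <-> (a, b) \in zip s t.
  split=> [[p [/Hf/mapP[[a' b'] ab ->] /= op]]|ab].
    by have [<- <-] := opair_inj (Hc a' b') op.
  by exists (c a b); split=> //; apply/Hf/mapP; exists (a, b).
have zipP a b : (a, b) \in zip s t <-> exists2 i, i < n & a = nth x s i /\ b = nth y t i.
  have st : size s = size t by rewrite sn.
  split=> [/(nthP (x, y))[i]|[i ni [-> ->]]].
    by rewrite size_zip sn tn minnn nth_zip // => ni [<- <-]; exists i.
  by rewrite -nth_zip // mem_nth // size_zip sn tn minnn.
exists f; split; [|split].
- move=> a /xs as_; exists (nth y t (index a s)); split.
    by apply/yt; rewrite mem_nth // tn -sn index_mem.
  by apply/appE/zipP; exists (index a s); rewrite -?sn ?index_mem ?nth_index.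
- move=> b /yt bt; exists (nth x s (index b t)); split.
    by apply/xs; rewrite mem_nth // sn -tn index_mem.
  by apply/appE/zipP; exists (index b t); rewrite -?tn ?index_mem ?nth_index.
- move=> a a' b b' _ _ _ _ /appE/zipP[i ni [-> ->]] /appE/zipP[j nj [-> ->]].
  by split=> /eqP; rewrite nth_uniq ?sn ?tn // => /eqP ->.
Qed.

(** From left to right, [x] has a bijection with itself, hence [y] has one with [x]. Conversely, any
    [z] in bijection with one of the two sets has [n] elements, hence is in bijection with the
    other. *)
Lemma sim_card n x y : full n -> card n x -> sim E x y <-> card n y.
Proof.
move=> F cx; split=> [xy|cy z]; last first.
  by split=> /card_bij H; apply: (bij_card F) => //; apply/H.
have /card_bij -> : bij E y x by apply/xy/(bij_card F).
by [].
Qed.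

(** If [A] forces cardinality [k] and is realized at least once, its saturation is functional, so
    the default case of [function] does not arise. *)
Lemma function_card (A : D -> D -> D -> Prop) m n k x y :
  full m -> full n -> full k -> card m x -> card n y ->
  (forall x' y' z', card m x' -> card n y' -> A x' y' z' -> card k z') ->
  (exists x' y' z', card m x' /\ card n y' /\ A x' y' z') ->
  forall z, function E (saturate E A) x y z <-> card k z.
Proof.
move=> Fm Fn Fk cx cy Ak [x0 [y0 [z0 [cx0 [cy0 A0]]]]].
have cz0 := Ak _ _ _ cx0 cy0 A0.
have satE z : saturate E A x y z <-> card k z.
  split=> [[x' [y' [z' [xx' [yy' [zz' H]]]]]]|cz].
    have cz' : card k z' by apply: Ak H; [apply/(sim_card _ Fm cx)|apply/(sim_card _ Fn cy)].
    exact/(sim_card _ Fk cz')/sim_sym.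
  exists x0, y0, z0; split; [exact/(sim_card _ Fm cx)|split; [exact/(sim_card _ Fn cy)|]].
  by split; first exact/(sim_card _ Fk cz).
have F : functional E (saturate E A) x y.
  by split=> [|z z' /satE cz /satE cz']; [exists z0; apply/satE|apply/(sim_card _ Fk cz)].
move=> z; split=> [[[_ /satE]|[]]|/satE cz] //.
by left.
Qed.

Lemma succ_card n x : full n.+1 -> card n x ->
  forall z, function E (saturate E (succ_rel E)) x x z <-> card n.+1 z.
Proof.
move=> F cx; have Fn := full_leq (leqnSn n) F.
have succE x' y z s : uniq s -> size s = n -> lists x' s -> y \notin s ->
    lists z (y :: s) -> card n.+1 z.
  by move=> us sn _ ys zs; exists (y :: s); split; rewrite //= ?ys ?sn.
apply: (function_card Fn Fn F) => //.
  move=> x' _ z' [s [us sn xs]] _ [y [yx zx]].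
  apply: (succE x' y z' s) => //; first by apply/negP => /xs.
  by move=> w; rewrite inE zx xs; split=> [[->|->]|/predU1P[|]]; rewrite ?eqxx ?orbT; auto.
have [s [us sn xs]] := cx.
have [y ys] : exists y, y \notin s by apply: fresh_element; rewrite sn.
have [|z zs] := F (y :: s); first by rewrite /= sn.
exists x, x, z; split=> //; split=> //; exists y; split; first by move/xs; apply/negP.
by move=> w; rewrite zs inE xs; split=> [/predU1P[|]|[->|->]]; rewrite ?eqxx ?orbT; auto.
Qed.

Lemma add_card m n x y : full m -> full n -> full (m + n) -> card m x -> card n y ->
  forall z, function E (saturate E (add_rel E)) x y z <-> card (m + n) z.
Proof.
move=> Fm Fn F cx cy; apply: (function_card Fm Fn F) => //.
  move=> x' y' z' [s [us <- xs]] [t [ut <- yt]] [dis zE]; exists (s ++ t); split.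
  - rewrite cat_uniq us ut andbT /=; apply/hasPn => w /yt wy; apply/negP => /xs wx.
    exact: dis wx wy.
  - by rewrite size_cat.
  - by move=> w; rewrite zE mem_cat xs yt; split=> /orP.
(* Disjoint representatives: [m + n] distinct elements are cut after the first [m]. *)
have [s us sn] := uniq_exists F.
have [|x' xs] := Fm (take m s); first by rewrite size_take_min geq_minl.
have [|y' ys] := Fn (drop m s); first by rewrite size_drop sn addKn.
have [z' zs] := F s (eq_leq sn).
move: us; rewrite -{1}(cat_take_drop m s) cat_uniq => /and3P[us1 /hasPn dis us2].
exists x', y', z'; split; [|split; [|split]].
- by exists (take m s); split=> //; rewrite size_takel // sn leq_addr.
- by exists (drop m s); split=> //; rewrite size_drop sn addKn.
- by move=> w /xs wx /ys /dis /negP; apply.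
- by move=> w; rewrite zs -{1}(cat_take_drop m s) mem_cat xs ys; split=> /orP.
Qed.

Lemma mul_card m n x y : full m -> full n -> full (m * n) -> card m x -> card n y ->
  forall z, function E (saturate E (mul_rel E)) x y z <-> card (m * n) z.
Proof.
move=> Fm Fn F cx cy; apply: (function_card Fm Fn F) => //.
  move=> x' y' z' [s [us <- xs]] [t [ut <- yt]] [H1 H2].
  (* [g] selects the only pair that the product contains for given components, so its values list
     the product without repetition. *)
  have /choice[g Hg] : forall ab : D * D, exists p, E ab.1 x' -> E ab.2 y' ->
      E p z' /\ opair E p ab.1 ab.2 /\
      (forall p', E p' z' -> opair E p' ab.1 ab.2 -> p' = p).
    move=> [a b] /=; have [ax|na] := EM (E a x'); last by exists a.
    by have [/(H2 _ _ ax)[p Hp]|nb] := EM (E b y'); [exists p|exists a].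
  exists [seq g (a, b) | a <- s, b <- t]; split.
  - apply: allpairs_uniq => // u u' /allpairsP[[a b] [/xs ax /yt bt ->]].
    case/allpairsP=> -[a' b'] [/xs ax' /yt bt' ->] /= gE.
    have [_ [op _]] := Hg (a, b) ax bt; have [_ [op' _]] := Hg (a', b') ax' bt'.
    by move: op'; rewrite -gE => /(opair_inj op) /= [-> ->].
  - by rewrite size_allpairs.
  - move=> p; split=> [pz|/allpairsP[[a b] [/xs ax /yt bt ->]]]; last first.
      by case: (Hg (a, b) ax bt).
    have [a [b [ax [bt op]]]] := H1 p pz; have [_ [_ H]] := Hg (a, b) ax bt.
    by apply/allpairsP; exists (a, b); split; [apply/xs|apply/yt|apply: H].
have [s [us sm xs]] := cx; have [t [ut tn yt]] := cy.
have [c Hc] := opair_exists.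
have [|z zs] := F [seq c a b | a <- s, b <- t]; first by rewrite size_allpairs sm tn.
exists x, y, z; split=> //; split=> //; split.
  move=> p /zs/allpairsP[[a b] [/xs ax /yt bt ->]].
  by exists a, b.
move=> a b /xs ax /yt bt; exists (c a b); split; first by apply/zs/allpairsP; exists (a, b).
split=> // p' /zs/allpairsP[[a' b'] [_ _ -> /= op]].
by have [<- <-] := opair_inj (Hc a' b') op.
Qed.

Lemma le_card n x y : full n -> card n y ->
  card_le E x y <-> exists2 k, k <= n & card k x.
Proof.
move=> F cy; split=> [[x' [y' [xx' [/(sim_card _ F cy)[t [ut tn yt]] H]]]]|[k kn cx]].
  (* A subset of a listed set is listed by filtering, with membership decided classically. *)
  pose s := [seq w <- t | `[< E w x' >]].
  have sn : size s <= n by rewrite -tn size_filter count_size.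
  have cx' : card (size s) x'.
    exists s; split=> //; first exact: filter_uniq.
    move=> w; rewrite mem_filter; split=> [wx|/andP[/asboolP]] //.
    by apply/andP; split; [apply/asboolP|apply/yt/H].
  exists (size s) => //.
  have Fs := full_leq sn F.
  exact/(sim_card _ Fs cx')/sim_sym.
have Fk := full_leq kn F; have [t [ut tn yt]] := cy.
have tk : size (take k t) = k by rewrite size_takel // tn.
have [x' xs] := Fk (take k t) (eq_leq tk).
exists x', y; split.
  by apply/(sim_card _ Fk cx); exists (take k t); split; rewrite ?take_uniq.
by split=> // w /xs /mem_take /yt.
Qed.

(** * Interpreted numerals and the axioms of [R0p] *)

Section Arithmetic.
Hypothesis emp_exists : exists e, emp E e.

Local Notation asat := (sat (sim E) (ap_rel E)).

(** Only [full n] is assumed, so that the numeral can be understood before larger finite sets are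
    known to exist. *)
Lemma sat_numeral n rho d (i : nat) : full n -> asat rho (value (numeral n) d i) <-> card n (rho i).
Proof.
elim: n rho d i => [|n IH] rho d i F; first by rewrite card0.
have Fn := full_leq (leqnSn n) F.
transitivity (exists x, card n x /\ function E (saturate E (succ_rel E)) x x (rho i)).
  by apply: sat_Ex => x; apply: sat_And => //; apply: IH.
split=> [[x [cx /(succ_card F cx)]] //|cz].
have [x cx] := card_exists Fn.
by exists x; split=> //; apply/(succ_card F cx).
Qed.

Lemma sat_binary n1 n2 (t1 t2 : term) (phi : form ap_sig) (A : D -> D -> Prop) rho d :
  (forall rho d i, asat rho (value t1 d i) <-> card n1 (rho i)) ->
  (forall rho d i, asat rho (value t2 d i) <-> card n2 (rho i)) ->
  (forall x y, asat (scons y (scons x rho)) phi <-> A x y) ->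
  asat rho (Ex (Ex (And (value t1 d.+2 1) (And (value t2 d.+2 0) phi)))) <->
  exists x y, card n1 x /\ card n2 y /\ A x y.
Proof.
move=> H1 H2 H; apply: sat_Ex => x; apply: sat_Ex => y.
by apply: sat_And (H1 _ _ _) (sat_And (H2 _ _ _) (H x y)).
Qed.

Lemma sat_PT n rho : full n -> asat rho (PT (numeral n)) <->
  exists x, card n x /\ adjoinable E x.
Proof.
by move=> F; apply: sat_Ex => x; apply: sat_And => //; apply: sat_numeral.
Qed.

(** A list with at most [n] distinct entries is covered by [full n]. Otherwise all but one of its
    [n.+1] distinct entries form a set similar to [x], to which the last one is adjoined. *)
Lemma adjoin_full n x : full n -> card n x -> adjoinable E x -> full n.+1.
Proof.
move=> F cx [_ [_ adj]] s sn; have [un|un] := leqP (size (undup s)) n.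
  by have [z zs] := F _ un; exists z => y; rewrite zs mem_undup.
have : size (undup s) = n.+1.
  by apply/eqP; rewrite eqn_leq un (leq_trans (size_undup s) sn).
case def_s: (undup s) => [|y t] //= [tn].
have ut : uniq (y :: t) by rewrite -def_s undup_uniq.
have [x' xt] := F t (eq_leq tn).
have [|z zx] := adj x' _ y.
  by apply/(sim_card _ F cx); exists t; split=> //; case/andP: ut.
exists z => w; rewrite zx xt -(mem_undup s) def_s inE.
by split=> [[->|->]|/predU1P[|]]; rewrite ?eqxx ?orbT; auto.
Qed.

Lemma sat_R0p rho phi : (forall n, full n) -> R0p phi -> asat rho phi.
Proof.
move=> F.
have num n rho' d (i : nat) : asat rho' (value (numeral n) d i) <-> card n (rho' i).
  exact: sat_numeral.
have add_num m n rho' d (i : nat) :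
    asat rho' (value (TAdd (numeral m) (numeral n)) d i) <-> card (m + n) (rho' i).
  rewrite [X in X <-> _](sat_binary _ (num m) (num n) (fun x y => iff_refl _)).
  split=> [[x [y [cx [cy H]]]]|cz]; first exact/(add_card _ _ _ cx cy).
  have [[x cx] [y cy]] := (card_exists (F m), card_exists (F n)).
  by exists x, y; split=> //; split=> //; apply/(add_card _ _ _ cx cy).
have mul_num m n rho' d (i : nat) :
    asat rho' (value (TMul (numeral m) (numeral n)) d i) <-> card (m * n) (rho' i).
  rewrite [X in X <-> _](sat_binary _ (num m) (num n) (fun x y => iff_refl _)).
  split=> [[x [y [cx [cy H]]]]|cz]; first exact/(mul_card _ _ _ cx cy).
  have [[x cx] [y cy]] := (card_exists (F m), card_exists (F n)).
  by exists x, y; split=> //; split=> //; apply/(mul_card _ _ _ cx cy).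
case=> [{}phi [m n|m n|m n mn|n|m n mn]|n].
- apply/(sat_binary _ (add_num m n) (num (m + n)) (fun x y => iff_refl _)).
  have [x cx] := card_exists (F (m + n)).
  by exists x, x; split=> //; split=> //; apply: sim_refl.
- apply/(sat_binary _ (mul_num m n) (num (m * n)) (fun x y => iff_refl _)).
  have [x cx] := card_exists (F (m * n)).
  by exists x, x; split=> //; split=> //; apply: sim_refl.
- move=> /(sat_binary _ (num m) (num n) (fun x y => iff_refl _)).
  move=> [x [y [cx [cy /(sim_card _ (F m) cx) cy']]]].
  exact/mn/(card_inj cy' cy).
- intros x; intros H.
  (* Unravelling the variable as a term gives a set [x'] that is only similar to [x]. *)
  have {H} [x' [y [xx' [cy xy]]]] : exists x' y, sim E x x' /\ card n y /\ card_le E x' y.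
    move: H; apply: (iffLR (sat_Ex _)) => x'; apply: sat_Ex => y.
    by apply: sat_And => //; apply: sat_And => //; apply: num.
  have /(le_card _ (F n) cy)[k kn cx] : card_le E x y.
    by apply: card_le_sim xy => //; apply: sim_sym.
  apply/(sat_BigOr (P := fun k => card k x)); last by exists k; rewrite // mem_iota.
  move=> {k kn cx} k _.
  transitivity (exists x1 x2, sim E x x1 /\ card k x2 /\ sim E x1 x2).
    apply: sat_Ex => x1; apply: sat_Ex => x2.
    by apply: sat_And => //; apply: sat_And => //; apply: num.
  split=> [[x1 [x2 [xx1 [cx2 x12]]]]|cx]; last by exists x, x.
  by apply/(sim_card _ (F k) cx2)/sim_sym/(sim_trans xx1).
- apply/(sat_binary _ (num m) (num n) (fun x y => iff_refl _)).
  have [[x cx] [y cy]] := (card_exists (F m), card_exists (F n)).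
  by exists x, y; split=> //; split=> //; apply/(le_card _ (F n) cy); exists m.
- apply/sat_PT => //; have [x cx] := card_exists (F n); exists x; split=> //.
  split=> //; split=> // x' /(sim_card _ (F n) cx)[s [_ _ xs]] y.
  (* [y] may already occur in [s]; [full] allows repetitions. *)
  have [z zs] := F _ (y :: s) (leqnn _); exists z => w; rewrite zs inE xs.
  by split=> [/predU1P[|]|[->|->]]; rewrite ?eqxx ?orbT; auto.
Qed.

End Arithmetic.
End Pairs.
End Cardinality.

(** * The two theories have the same models *)

Lemma VS_models (D : eqType) (E : D -> D -> Prop) (rho : nat -> D) :
  (forall psi, VS psi -> sat eq (set_rel E) rho psi) <-> (forall n, full E n).
Proof.
split=> [H n s _|F _ [n]].
  have [z zs] := (sat_VS_axiom E rho (size s)).1 (H _ (VS_intro _)) s erefl.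
  by exists z => y; rewrite zs In_mem.
apply/sat_VS_axiom => s _; have [z zs] := F _ s (leqnn _).
by exists z => y; rewrite zs In_mem.
Qed.

Lemma translated_models (D : eqType) (E : D -> D -> Prop) (rho : nat -> D) :
  (forall psi, translate_theory card_translation (theory_union R0p id_ap) psi ->
     sat eq (set_rel E) rho psi) <-> (forall n, full E n).
Proof.
split=> [H n|F _ [phi [Tphi ->]]].
  have HP k : sat (sim E) (ap_rel E) rho (PT (numeral k)).
    by apply/sat_translate/H; exists (PT (numeral k)); split=> //; left; apply: R0p_P.
  (* The axiom for zero already supplies the empty set and all pairs, on which the analysis of the
     other numerals rests. *)
  have [x [ex [[e He] [pairs _]]]] : exists x, emp E x /\ adjoinable E x.
    by move: (HP 0); apply: (iffLR (sat_Ex _)) => x; apply: sat_And.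
  elim: n => [|n F].
    by move=> s; rewrite leqn0 => /nilP ->; exists e => y; split=> // /He.
  (* By the induction hypothesis the numeral denotes the sets with [n] elements, so its axiom is
     about adjunction to these. *)
  have [y [cy Py]] := (sat_PT pairs rho F).1 (HP n).
  exact: adjoin_full Py.
have [e He] : exists e, emp E e.
  by have [e He] := F 0 [::] isT; exists e => y /He.
have pairs a b : exists z, pairset E z a b.
  have [z zs] := F 2 [:: a; b] isT; exists z => y; rewrite zs !inE.
  by split=> [/orP[]/eqP|[] ->]; rewrite ?eqxx ?orbT; auto.
apply/sat_translate; case: Tphi => [|Tphi]; first by apply: sat_R0p => //; exists e.
by apply: sat_id_ap => //; exists e.
Qed.

(** * Countability of the formulas and passage from models to proofs *)

Fixpoint set_form_of_tree (t : GenTree.tree nat) : form set_sig :=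
  match t with
  | GenTree.Node 0 [:: GenTree.Leaf x; GenTree.Leaf y] => Eq x y
  | GenTree.Node 1 [:: GenTree.Leaf x; GenTree.Leaf y] => in_ x y
  | GenTree.Node 2 [:: t1; t2] => Imp (set_form_of_tree t1) (set_form_of_tree t2)
  | GenTree.Node 3 [:: t1] => All (set_form_of_tree t1)
  | _ => Bot
  end.

(** Completeness asks only for a surjective enumeration, so trees that code nothing may all be read
    as [Bot]. *)
Lemma set_form_of_tree_surj phi : exists t, set_form_of_tree t = phi.
Proof.
elim: phi => [|x y|[] v|phi1 [t1 <-] phi2 [t2 <-]|phi1 [t1 <-]].
- by exists (GenTree.Leaf 0).
- by exists (GenTree.Node 0 [:: GenTree.Leaf x; GenTree.Leaf y]).
- case: v => -[|x [|y [|z s]]] // vr.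
  exists (GenTree.Node 1 [:: GenTree.Leaf x; GenTree.Leaf y]).
  by congr Rel; apply: val_inj.
- by exists (GenTree.Node 2 [:: t1; t2]).
- by exists (GenTree.Node 3 [:: t1]).
Qed.

Definition set_form_enum n : form set_sig :=
  if unpickle n is Some t then set_form_of_tree t else Bot.

Lemma set_form_enum_surj phi : exists n, set_form_enum n = phi.
Proof.
have [t <-] := set_form_of_tree_surj phi.
by exists (pickle t); rewrite /set_form_enum pickleK.
Qed.

Lemma set_relE (D : Type) (rel : sym set_sig -> seq D -> Prop) rho phi :
  sat eq rel rho phi <-> sat eq (set_rel (fun x y => rel tt [:: x; y])) rho phi.
Proof.
elim: phi rho => //= [[] v|phi1 IH1 phi2 IH2|phi1 IH] rho.
- by case: v => -[|x [|y [|z s]]].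
- by rewrite IH1 IH2.
- by split=> H d; apply/IH.
Qed.

(** Soundness for [T], then completeness for [U]; [set_relE] reduces arbitrary interpretations to
    binary relations. *)
Lemma proves_of_models (T U : theory set_sig) phi :
  (forall (D : eqType) (E : D -> D -> Prop) rho,
     (forall psi, U psi -> sat eq (set_rel E) rho psi) ->
     (forall psi, T psi -> sat eq (set_rel E) rho psi)) ->
  proves T phi -> proves U phi.
Proof.
move=> UT /proves_entails Tphi; apply: (completeness set_form_enum_surj) => D rel rho HU.
apply: Tphi => psi Tpsi; apply/set_relE; apply: UT psi Tpsi => chi /HU.
by move/set_relE.
Qed.

Theorem theorem5p6 :
  exists tau : translation ap_sig set_sig,
    deductively_equivalent VS
      (translate_theory tau (theory_union R0p id_ap)).
Proof.
exists card_translation => phi; split; apply: proves_of_models => D E rho.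
  by move=> /translated_models F; apply/VS_models.
by move=> /VS_models F; apply/translated_models.
Qed.
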